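(* For any field $\mathbb{K}$, the affine subgroup $\mathrm{Aff}_3(\mathbb{K})$ is not a maximal subgroup of the tame automorphism group $\mathrm{TA}_3(\mathbb{K})$.
   Context: $\mathrm{GA}_3(\mathbb{K})$ is the group of triples $\phi=(\phi_1,\phi_2,\phi_3)\in\mathbb{K}[x,y,z]^3$ that are invertible for the composition $\phi\psi=(\phi_1(\psi_1,\psi_2,\psi_3),\phi_2(\psi_1,\psi_2,\psi_3),\phi_3(\psi_1,\psi_2,\psi_3))$, with identity $(x,y,z)$. $\mathrm{Aff}_3(\mathbb{K})$ is the subgroup of those $\phi\in\mathrm{GA}_3(\mathbb{K})$ whose three components all have total degree $1$. $\mathrm{BA}_3(\mathbb{K})$ is the subgroup of those $\phi\in \mathrm{GA}_3(\mathbb{K})$ with $\phi_1\in\mathbb{K}^*x+\mathbb{K}[y,z]$, $\phi_2\in\mathbb{K}^*y+\mathbb{K}[z]$, $\phi_3\in\mathbb{K}^*z+\mathbb{K}$. The tame subgroup is $\mathrm{TA}_3(\mathbb{K})=\langle \mathrm{Aff}_3(\mathbb{K}),\mathrm{BA}_3(\mathbb{K})\rangle$. *)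

(* Defs.v *)
From HB Require Import structures.
From mathcomp Require Import all_boot all_algebra.
From mathcomp Require Import mpoly.

Set Implicit Arguments.
Unset Strict Implicit.
Unset Printing Implicit Defensive.

Import GRing.Theory.
Local Open Scope ring_scope.

(* Subgroups of a possibly infinite group; membership is a Prop, since the
   library's [groupClosed] only covers boolean predicates. *)

Record subgroup (G : groupType) := Subgroup {
  subgroup_mem :> G -> Prop;
  subgroup1 : subgroup_mem 1%g;
  subgroupM : forall g h, subgroup_mem g -> subgroup_mem h ->
                subgroup_mem (g * h)%g;
  subgroupV : forall g, subgroup_mem g -> subgroup_mem (g^-1)%g
}.

Definition included (G : groupType) (A B : G -> Prop) : Prop :=
  forall g, A g -> B g.

Section Generated.
Variables (G : groupType) (S : G -> Prop).

Definition generated_mem (g : G) : Prop :=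
  forall H : subgroup G, included S H -> H g.

Lemma generated1 : generated_mem 1%g.
Proof. by move=> H _; apply: subgroup1. Qed.

Lemma generatedM g h :
  generated_mem g -> generated_mem h -> generated_mem (g * h)%g.
Proof. by move=> Sg Sh H SH; apply: subgroupM; [apply: Sg | apply: Sh]. Qed.

Lemma generatedV g : generated_mem g -> generated_mem (g^-1)%g.
Proof. by move=> Sg H SH; apply: subgroupV; apply: Sg. Qed.

Definition generated : subgroup G :=
  Subgroup generated1 generatedM generatedV.

End Generated.

Definition maximal_subgroup (G : groupType) (H T : subgroup G) : Prop :=
  [/\ included H T,
      ~ included T H &
      forall L : subgroup G, included H L -> included L T ->
        included L H \/ included T L].

Section PolynomialAutomorphisms.
Variable K : fieldType.

Definition triple := 3.-tuple {mpoly K[3]}.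

Definition triple_comp (phi psi : triple) : triple :=
  [tuple tnth phi i \mPo psi | i < 3].

Definition triple_id : triple := [tuple 'X_i | i < 3].

Lemma triple_comp1 phi : triple_comp phi triple_id = phi.
Proof. by apply: eq_from_tnth => i; rewrite tnth_mktuple comp_mpoly_id. Qed.

Lemma triple_1comp phi : triple_comp triple_id phi = phi.
Proof.
by apply: eq_from_tnth => i; rewrite !tnth_mktuple comp_mpolyXU -tnth_nth.
Qed.

Lemma comp_mpolyA (p : {mpoly K[3]}) (phi psi : triple) :
  (p \mPo phi) \mPo psi = p \mPo triple_comp phi psi.
Proof.
rewrite [p \mPo phi]comp_mpolyEX [RHS]comp_mpolyEX raddf_sum /=.
apply: eq_bigr => m _; rewrite comp_mpolyZ !comp_mpolyX rmorph_prod /=.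
congr (_ *: _); apply: eq_bigr => i _.
by rewrite rmorphXn /= tnth_mktuple.
Qed.

Lemma triple_compA : associative triple_comp.
Proof.
move=> f g h; apply: eq_from_tnth => i.
by rewrite !tnth_mktuple comp_mpolyA.
Qed.

Definition mutually_inverse (p : triple * triple) : bool :=
  (triple_comp p.1 p.2 == triple_id) && (triple_comp p.2 p.1 == triple_id).

(* An invertible triple is stored together with its (unique) inverse, so that
   inversion is computable and equality is that of the underlying triples. *)
Record GA3 := MkGA3 {
  GA3_pair : triple * triple;
  GA3P : mutually_inverse GA3_pair
}.

HB.instance Definition _ := [isSub for GA3_pair].
HB.instance Definition _ := [Choice of GA3 by <:].

Definition components (f : GA3) : triple := (GA3_pair f).1.

Lemma GA3_compV (f : GA3) :
  triple_comp (GA3_pair f).1 (GA3_pair f).2 = triple_id.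
Proof. by case: f => p /= /andP[/eqP]. Qed.

Lemma GA3_compVl (f : GA3) :
  triple_comp (GA3_pair f).2 (GA3_pair f).1 = triple_id.
Proof. by case: f => p /= /andP[_ /eqP]. Qed.

Lemma components_inj : injective components.
Proof.
move=> f g fg; apply: val_inj => /=.
have fg2 : (GA3_pair f).2 = (GA3_pair g).2.
  rewrite -[LHS]triple_comp1 -(GA3_compV g) triple_compA.
  by rewrite -[(GA3_pair g).1]fg GA3_compVl triple_1comp.
by move: fg fg2; case: f g => [[f1 f2] ?] [[g1 g2] ?]; rewrite /components /= => -> ->.
Qed.

Lemma invertible_components (phi : triple) :
  (exists psi, triple_comp phi psi = triple_id /\
               triple_comp psi phi = triple_id) <->
  (exists f : GA3, components f = phi).
Proof.
split=> [[psi [h1 h2]] | [f <-]].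
  have h : mutually_inverse (phi, psi) by rewrite /mutually_inverse /= h1 h2 !eqxx.
  by exists (MkGA3 h).
by exists (GA3_pair f).2; split; [apply: GA3_compV | apply: GA3_compVl].
Qed.

Fact GA3_one_subproof : mutually_inverse (triple_id, triple_id).
Proof. by rewrite /mutually_inverse /= triple_comp1 eqxx. Qed.

Fact GA3_mul_subproof (f g : GA3) :
  mutually_inverse (triple_comp (GA3_pair f).1 (GA3_pair g).1,
                    triple_comp (GA3_pair g).2 (GA3_pair f).2).
Proof.
rewrite /mutually_inverse /=; apply/andP; split; apply/eqP.
  rewrite triple_compA -[in X in triple_comp X _]triple_compA.
  by rewrite GA3_compV triple_comp1 GA3_compV.
rewrite triple_compA -[in X in triple_comp X _]triple_compA.
by rewrite GA3_compVl triple_comp1 GA3_compVl.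
Qed.

Fact GA3_inv_subproof (f : GA3) :
  mutually_inverse ((GA3_pair f).2, (GA3_pair f).1).
Proof. by rewrite /mutually_inverse /= GA3_compV GA3_compVl eqxx. Qed.

Definition GA3_one : GA3 := MkGA3 GA3_one_subproof.
Definition GA3_mul (f g : GA3) : GA3 := MkGA3 (GA3_mul_subproof f g).
Definition GA3_inv (f : GA3) : GA3 := MkGA3 (GA3_inv_subproof f).

Fact GA3_mulA : associative GA3_mul.
Proof. by move=> f g h; apply: components_inj; apply: triple_compA. Qed.

Fact GA3_1mul : left_id GA3_one GA3_mul.
Proof. by move=> f; apply: components_inj; apply: triple_1comp. Qed.

Fact GA3_mul1 : right_id GA3_one GA3_mul.
Proof. by move=> f; apply: components_inj; apply: triple_comp1. Qed.

Fact GA3_mulV : left_inverse GA3_one GA3_inv GA3_mul.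
Proof. by move=> f; apply: components_inj; apply: GA3_compVl. Qed.

Fact GA3_mulVr : right_inverse GA3_one GA3_inv GA3_mul.
Proof. by move=> f; apply: components_inj; apply: GA3_compV. Qed.

HB.instance Definition _ := isGroup.Build GA3
  GA3_mulA GA3_1mul GA3_mul1 GA3_mulV GA3_mulVr.

(* [msize p] is one more than the total degree of [p != 0]. *)
Definition Aff3_mem (f : GA3) : Prop :=
  forall i : 'I_3, msize (tnth (components f) i) = 2%N.

Lemma msize_le2P (p : {mpoly K[3]}) :
  (msize p <= 2)%N ->
  p = (p@_0)%:MP + \sum_(j < 3) p@_U_(j) *: 'X_j.
Proof.
move=> szp; apply/mpolyP => m; rewrite mcoeffD mcoeffC raddf_sum /=.
have [m_gt1 | m_le1] := ltnP 1 (mdeg m).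
  have -> : p@_m = 0 by rewrite memN_msupp_eq0 ?msize_mdeg_ge ?(leq_trans szp).
  rewrite big1 => [|j _].
    case: eqP m_gt1 => [->|_ _]; first by rewrite mdeg0.
    by rewrite mulr0 addr0.
  rewrite mcoeffZ mcoeffX; case: eqP m_gt1 => [<-|_ _]; last by rewrite mulr0.
  by rewrite mdeg1.
have [m0 | ] := eqVneq (mdeg m) 0%N.
  move/eqP: m0; rewrite mdeg_eq0 => /eqP ->.
  rewrite eqxx mulr1 big1 ?addr0 // => j _.
  by rewrite mcoeffZ mcoeffX mnm1_eq0 mulr0.
move=> m_neq0; have /eqP/mdeg1P[i /eqP ->] : mdeg m = 1%N.
  by apply/eqP; rewrite eqn_leq m_le1 lt0n.
rewrite mnm1_eq0 mulr0 add0r (bigD1 i) //= big1 => [|j ji].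
  by rewrite mcoeffZ mcoeffX eqxx mulr1 addr0.
by rewrite mcoeffZ mcoeffX eq_mnm1 (negbTE ji) mulr0.
Qed.

Lemma msize_affine (c : K) (a : 'I_3 -> K) (q : 'I_3 -> {mpoly K[3]}) :
  (forall j, (msize (q j) <= 2)%N) ->
  (msize (c%:MP + \sum_(j < 3) a j *: q j) <= 2)%N.
Proof.
move=> szq; apply: (leq_trans (msizeD_le _ _)); rewrite geq_max.
rewrite msizeC (leq_trans (leq_b1 _)) //=.
apply: (leq_trans (msize_sum _ _ _)); apply/bigmax_leqP_seq => j _ _.
exact: leq_trans (msizeZ_le _ _) (szq j).
Qed.

Lemma msize_comp_le2 (p : {mpoly K[3]}) (phi : triple) :
  (msize p <= 2)%N -> (forall i, (msize (tnth phi i) <= 2)%N) ->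
  (msize (p \mPo phi) <= 2)%N.
Proof.
move=> /msize_le2P -> szphi; rewrite comp_mpolyD comp_mpolyC raddf_sum /=.
under eq_bigr => j _ do rewrite comp_mpolyZ comp_mpolyXU -tnth_nth.
exact: msize_affine.
Qed.

Lemma msize_component_gt1 (f : GA3) i : (1 < msize (tnth (components f) i))%N.
Proof.
rewrite ltnNge; apply/negP => /msize1_polyC fi.
have := congr1 (fun t => msize (tnth t i)) (GA3_compV f).
rewrite !tnth_mktuple -/(components f) fi comp_mpolyC msizeX mdeg1 => sz.
by move: sz; rewrite msizeC; case: (_ != 0).
Qed.

Lemma Aff3_memP (f : GA3) :
  (forall i, (msize (tnth (components f) i) <= 2)%N) -> Aff3_mem f.
Proof.
by move=> szf i; apply/eqP; rewrite eqn_leq szf msize_component_gt1.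
Qed.

Lemma Aff3_1 : Aff3_mem 1%g.
Proof. by move=> i; rewrite tnth_mktuple msizeX mdeg1. Qed.

Lemma Aff3_M f g : Aff3_mem f -> Aff3_mem g -> Aff3_mem (f * g)%g.
Proof.
move=> Af Ag; apply: Aff3_memP => i; rewrite tnth_mktuple.
by apply: msize_comp_le2 => [|j]; rewrite ?Af ?Ag.
Qed.

Lemma Aff3_V f : Aff3_mem f -> Aff3_mem (f^-1)%g.
Proof.
move=> Af; apply: Aff3_memP => i.
set phi := components f; set psi := components _.
have psiE j : 'X_j = ((tnth phi j)@_0)%:MP
                     + \sum_(k < 3) (tnth phi j)@_U_(k) *: tnth psi k.
  have := congr1 (fun t => tnth t j) (GA3_compV f).
  rewrite !tnth_mktuple -/(components f) -/phi => <-.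
  rewrite {1}(@msize_le2P (tnth phi j)) ?Af //.
  rewrite comp_mpolyD comp_mpolyC raddf_sum /=; congr (_ + _).
  by apply: eq_bigr => k _; rewrite comp_mpolyZ comp_mpolyXU -tnth_nth.
pose A : 'M[K]_3 := \matrix_(j, k) (tnth phi j)@_U_(k).
pose L : 'M[K]_3 := \matrix_(j, k) (tnth psi j)@_U_(k).
have AL : A *m L = 1%:M.
  apply/matrixP => j l; rewrite !mxE.
  have := congr1 (mcoeff U_(l)) (psiE j).
  rewrite mcoeffD mcoeffC mnm1_eq0 mulr0 add0r raddf_sum /= mcoeffX.
  rewrite eq_mnm1 => ->; apply: eq_bigr => k _.
  by rewrite mcoeffZ !mxE.
have LA := mulmx1C AL.
have -> : tnth psi i = \sum_j L i j *: ('X_j - ((tnth phi j)@_0)%:MP).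
  have -> : tnth psi i = \sum_k (L *m A) i k *: tnth psi k.
    rewrite LA (bigD1 i) //= big1 => [|k ki].
      by rewrite mxE eqxx scale1r addr0.
    by rewrite mxE eq_sym (negbTE ki) scale0r.
  under [RHS]eq_bigr => j _ do rewrite {1}psiE [_ + _ - _]addrAC subrr add0r.
  under [LHS]eq_bigr => k _ do rewrite [(L *m A) i k]mxE scaler_suml.
  rewrite exchange_big /=; apply: eq_bigr => j _.
  rewrite scaler_sumr; apply: eq_bigr => k _.
  by rewrite scalerA [A j k]mxE.
rewrite -[X in msize X]add0r -mpolyC0; apply: msize_affine => j.
rewrite (leq_trans (msizeD_le _ _)) // msizeN geq_max msizeX mdeg1 /=.
by rewrite msizeC (leq_trans (leq_b1 _)).
Qed.

Definition Aff3 : subgroup GA3 := Subgroup Aff3_1 Aff3_M Aff3_V.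

(* [p] lies in the subring generated over [K] by the variables whose index
   satisfies [P]; the indices 0, 1, 2 stand for x, y, z. *)
Definition only_vars (P : pred 'I_3) (p : {mpoly K[3]}) : Prop :=
  forall m i, m \in msupp p -> ~~ P i -> m i = 0%N.

Definition BA3 (f : GA3) : Prop :=
  forall i : 'I_3, exists (a : K) (p : {mpoly K[3]}),
    [/\ a != 0, only_vars (fun j : 'I_3 => (i < j)%N) p &
        tnth (components f) i = a *: 'X_i + p].

Definition TA3 : subgroup GA3 := generated (fun f => Aff3 f \/ BA3 f).

End PolynomialAutomorphisms.

(* Main.v *)
(* Let n be 2 or 3, with n nonzero in K, and consider the involutions
   b = (-x + y^n z, y, z), p = (y, x, z) and theta = b p b p b p b p b.
   The subgroup <Aff_3, theta> contains no element of degree at most n + 1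
   that is not affine, so it misses b.
   Indeed, call a triple dominant when its first component has the largest
   degree; b p preserves dominance. The key step: if u is dominant and its
   first component has more than twice the degree of the third, then for every
   affine a the triple b a b p u is dominant, unless a multiplies y and z by
   constants and scales the monomials x and y^n z by the same factor; then
   b a b is again affine and the argument can be repeated with p b a b p.
   An affine map that is exceptional twice is diagonal and commutes with b, and
   its conjugate by theta is affine. Hence a word a_0 theta a_1 theta ... that
   cannot be shortened keeps growing in degree. *)

Require Import Defs.
From mathcomp Require Import all_boot all_algebra.
From mathcomp Require Import mpoly.
From mathcomp Require Import zify ring.

Set Implicit Arguments.
Unset Strict Implicit.
Unset Printing Implicit Defensive.

Import GRing.Theory.
Local Open Scope ring_scope.

(** * Degree calculus for polynomials over a field *)

Section Degree.
Variables (K : fieldType) (k : nat).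
Implicit Types p q r : {mpoly K[k]}.

(* The zero polynomial gets degree [0]. *)
Definition tdeg p := (msize p).-1.

Lemma tdegC c : tdeg (c%:MP : {mpoly K[k]}) = 0%N.
Proof. by rewrite /tdeg msizeC; case: (c != 0). Qed.

Lemma tdegN p : tdeg (- p) = tdeg p.
Proof. by rewrite /tdeg msizeN. Qed.

Lemma tdegD_le p q m :
  (tdeg p <= m)%N -> (tdeg q <= m)%N -> (tdeg (p + q) <= m)%N.
Proof. by move: (msizeD_le p q); rewrite /tdeg; lia. Qed.

Lemma tdegDl p q : (tdeg q < tdeg p)%N -> tdeg (p + q) = tdeg p.
Proof.
move=> qp; apply/eqP; rewrite eqn_leq tdegD_le ?(ltnW qp) //=.
have: (tdeg p <= maxn (tdeg (p + q)) (tdeg q))%N.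
  have {1}-> : p = (p + q) - q by rewrite addrK.
  by rewrite tdegD_le ?tdegN ?leq_maxl ?leq_maxr.
by move: qp; lia.
Qed.

Lemma tdegDr p q : (tdeg p < tdeg q)%N -> tdeg (p + q) = tdeg q.
Proof. by rewrite addrC => /tdegDl. Qed.

Lemma tdegM p q : p != 0 -> q != 0 -> tdeg (p * q) = (tdeg p + tdeg q)%N.
Proof.
move=> p0 q0; rewrite /tdeg.
have -> : msize (p * q) = (msize p + msize q).-1 := msizeM p0 q0.
have sz_gt0 r : r != 0 -> (0 < msize r)%N by rewrite lt0n msize_poly_eq0.
by move: (sz_gt0 p p0) (sz_gt0 q q0); lia.
Qed.

Lemma tdegM_le p q m : (tdeg p + tdeg q <= m)%N -> (tdeg (p * q) <= m)%N.
Proof.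
have [->|p0] := eqVneq p 0; first by rewrite mul0r -mpolyC0 tdegC.
have [->|q0] := eqVneq q 0; first by rewrite mulr0 -mpolyC0 tdegC.
by rewrite tdegM.
Qed.

Lemma tdegX p n : p != 0 -> tdeg (p ^+ n) = (n * tdeg p)%N.
Proof.
move=> p0; elim: n => [|n IHn]; first by rewrite expr0 -mpolyC1 tdegC.
by rewrite exprS tdegM ?expf_neq0 // IHn mulSn.
Qed.

Lemma tdegX_le p n : (tdeg (p ^+ n) <= n * tdeg p)%N.
Proof.
have [->|/tdegX->//] := eqVneq p 0.
by rewrite expr0n -mpolyC_nat tdegC.
Qed.

Lemma tdegCM c p : c != 0 -> tdeg (c%:MP * p) = tdeg p.
Proof. by move=> c0; rewrite mul_mpolyC /tdeg msizeZ. Qed.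

Lemma tdegCM_le c p m : (tdeg p <= m)%N -> (tdeg (c%:MP * p) <= m)%N.
Proof. by move=> pm; rewrite tdegM_le // tdegC. Qed.

Lemma mulC_divK (s t : K) :
  s != 0 -> s%:MP * (t / s)%:MP = t%:MP :> {mpoly K[k]}.
Proof. by move=> s0; rewrite -mpolyCM mulrC divfK. Qed.

(** Pulling out [s] leaves a shift of [p], the shape treated by [tdeg_shift_prod]. *)
Lemma affine_factor (c s t : K) p q : s != 0 ->
  c%:MP + s%:MP * p + t%:MP * q =
  s%:MP * (p + ((c / s)%:MP + (t / s)%:MP * q)).
Proof.
move=> s0; rewrite 2!mulrDr mulrA !mulC_divK //.
by rewrite [c%:MP + _]addrC -addrA.
Qed.

Lemma tdeg_neq0 p : (0 < tdeg p)%N -> p != 0.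
Proof. by apply: contraTneq => ->; rewrite -mpolyC0 tdegC. Qed.

Lemma tdegMX n p q : (0 < tdeg p)%N -> (0 < tdeg q)%N ->
  tdeg (p ^+ n * q) = (n * tdeg p + tdeg q)%N.
Proof.
by move=> /tdeg_neq0 p0 /tdeg_neq0 q0; rewrite tdegM ?tdegX ?expf_neq0.
Qed.

Lemma tdeg_affine_le (c a0 a1 a2 : K) p q r m :
  (tdeg p <= m)%N -> (tdeg q <= m)%N -> (tdeg r <= m)%N ->
  (tdeg (c%:MP + a0%:MP * p + a1%:MP * q + a2%:MP * r) <= m)%N.
Proof.
by move=> pm qm rm; do !apply: tdegD_le; rewrite ?tdegCM_le ?tdegC.
Qed.

(** * Degree of [p ^+ n * q] under affine shifts of [p] and [q] *)

Section Expansion.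
Variables (n : nat) (p q d : {mpoly K[k]}).
Hypotheses (n23 : n = 2%N \/ n = 3%N) (nK : n%:R != 0 :> K).
Hypotheses (q_gt0 : (0 < tdeg q)%N) (qp : (tdeg q < tdeg p)%N).
Hypothesis dq : (tdeg d <= tdeg q)%N.

(** The cofactor [e] has leading part [n%:R * p ^+ n.-1], which survives because [n%:R != 0]; its
    other terms contain [d], of lower degree than [p]. *)
Lemma shiftX_factor : exists2 e : {mpoly K[k]},
  (p + d) ^+ n - p ^+ n = d * e & tdeg e = (n.-1 * tdeg p)%N.
Proof.
have p0 : p != 0 by apply: tdeg_neq0; lia.
have cE (m : nat) : m%:R = (m%:R : K)%:MP :> {mpoly K[k]} by rewrite mpolyC_nat.
case: n23 nK => -> cK.
  exists (2%:R * p + d); first by rewrite !exprS !expr0; ring.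
  by rewrite cE tdegDl tdegCM //=; lia.
exists (3%:R * p ^+ 2 + (3%:R * p * d + d ^+ 2)).
  by rewrite !exprS !expr0; ring.
rewrite cE; have pdd : (tdeg (3%:R%:MP * p * d + d ^+ 2) <= tdeg p + tdeg q)%N.
  apply: tdegD_le; last by move: (tdegX_le d 2); lia.
  by apply: tdegM_le; rewrite tdegCM //; lia.
by rewrite tdegDl tdegCM ?tdegX //; apply: leq_ltn_trans pdd _; lia.
Qed.

(* With [p] and [q] of very different degrees, the affine substitution
   [p -> p + d], [q -> q + c] changes [p ^+ n * q] in high degree: by about
   [c * p ^+ n] if [c != 0], and otherwise by [n * d * p ^+ n.-1 * q]. This is
   where [n%:R != 0] matters. *)
Lemma tdeg_shift_prod (c : K) (s m : K) : m != 0 ->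
    (2 * tdeg q < tdeg p)%N ->
    ~ [/\ d = 0, c = 0 & m = s] ->
  (tdeg p <
   tdeg (m%:MP * ((p + d) ^+ n * (q + c%:MP)) - s%:MP * (p ^+ n * q)))%N.
Proof.
move=> m0 q2p nexc; have [e eE e_deg] := shiftX_factor.
have p_gt0 : (0 < tdeg p)%N by lia.
have p0 := tdeg_neq0 p_gt0; have q0 := tdeg_neq0 q_gt0.
(* The terms carrying [m - s], [c] and [d] are separated: in this order their degrees decrease, so
   the first nonzero one decides. *)
have -> : m%:MP * ((p + d) ^+ n * (q + c%:MP)) - s%:MP * (p ^+ n * q) =
    m%:MP * (d * e * (q + c%:MP) + c%:MP * p ^+ n) +
    (m - s)%:MP * (p ^+ n * q) by rewrite mpolyCB -eE; ring.
have Pn : (tdeg p + tdeg p <= n * tdeg p)%N by case: n23 => ->; lia.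
have nP : (n * tdeg p = tdeg p + n.-1 * tdeg p)%N by case: n23 => ->; lia.
(* The degree is at most [2 * tdeg q + n.-1 * tdeg p], hence the factor 2 in the hypothesis. *)
have deq : (tdeg (d * e * (q + c%:MP)) < n * tdeg p)%N.
  suff: (tdeg (d * e * (q + c%:MP)) <= tdeg d + tdeg e + tdeg q)%N by lia.
  apply: tdegM_le; apply: leq_add; first exact: tdegM_le.
  by rewrite tdegD_le ?tdegC.
have [ms|ms] := eqVneq m s; last first.
  have lead : tdeg ((m - s)%:MP * (p ^+ n * q)) = (n * tdeg p + tdeg q)%N.
    by rewrite tdegCM ?subr_eq0 // tdegMX.
  rewrite tdegDr lead; first by lia.
  rewrite tdegCM //; apply: leq_ltn_trans (_ : _ <= n * tdeg p)%N _; last lia.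
  by apply: tdegD_le; [exact: ltnW | rewrite tdegCM_le // tdegX].
rewrite -ms subrr mpolyC0 mul0r addr0 tdegCM //.
have [c0|c0] := eqVneq c 0; last first.
  by rewrite tdegDr tdegCM ?tdegX //; lia.
rewrite c0 mpolyC0 mul0r !addr0.
(* What is left, [d * e * q], has degree at least [n.-1 * tdeg p + tdeg q], and [q] is not
   constant. *)
have d0 : d != 0 by apply/eqP => d0; apply: nexc.
have e0 : e != 0.
  by apply: tdeg_neq0; rewrite e_deg; case: n23 => ->; lia.
by rewrite !tdegM ?mulf_neq0 // e_deg; lia.
Qed.

End Expansion.

End Degree.

(** * Components of automorphisms and left multiplication by affine maps *)

Section Action.
Variable K : fieldType.
Implicit Types a f g u w : GA3 K.

Local Notation x := (@Ordinal 3 0 isT).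
Local Notation y := (@Ordinal 3 1 isT).
Local Notation z := (@Ordinal 3 2 isT).

Definition cmp f (i : 'I_3) : {mpoly K[3]} := tnth (components f) i.
Definition deg f i := tdeg (cmp f i).

Lemma ord3P (P : 'I_3 -> Prop) : P x -> P y -> P z -> forall i, P i.
Proof.
move=> Px Py Pz [[|[|[|m]]] lt_i3] //.
- by rewrite (_ : Ordinal _ = x) //; apply: val_inj.
- by rewrite (_ : Ordinal _ = y) //; apply: val_inj.
- by rewrite (_ : Ordinal _ = z) //; apply: val_inj.
Qed.

Lemma sum_ord3 (F : 'I_3 -> {mpoly K[3]}) : \sum_(i < 3) F i = F x + F y + F z.
Proof.
rewrite !big_ord_recl big_ord0 addr0 addrA.
by congr (F _ + F _ + F _); apply: val_inj.
Qed.

Lemma cmp_ext f g : cmp f x = cmp g x -> cmp f y = cmp g y ->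
  cmp f z = cmp g z -> f = g.
Proof.
move=> fx fy fz; apply: components_inj; apply: eq_from_tnth.
exact: ord3P fx fy fz.
Qed.

Lemma cmpM f g i : cmp (f * g)%g i = cmp f i \mPo components g.
Proof. by rewrite /cmp tnth_mktuple. Qed.

Lemma XU_comp g i : 'X_i \mPo components g = cmp g i.
Proof. by rewrite comp_mpolyXU -tnth_nth. Qed.

Lemma deg_gt0 f i : (0 < deg f i)%N.
Proof. by move: (msize_component_gt1 f i); rewrite /deg /tdeg /cmp; lia. Qed.

(** Composing with the inverse of [w] recovers [p] and fixes constants. *)
Lemma comp_const (p : {mpoly K[3]}) w (c : K) :
  p \mPo components w = c%:MP -> p = c%:MP.
Proof.
move=> pc; have := congr1 (fun r => r \mPo (GA3_pair w).2) pc.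
by rewrite comp_mpolyA GA3_compV comp_mpoly_id comp_mpolyC.
Qed.

Definition cst a i := (cmp a i)@_0%MM.
Definition lin a i j := (cmp a i)@_U_(j).

Lemma aff_cmp a i : Aff3 K a -> cmp a i =
  (cst a i)%:MP + (lin a i x)%:MP * 'X_x + (lin a i y)%:MP * 'X_y
  + (lin a i z)%:MP * 'X_z.
Proof.
move=> Aa; rewrite {1}(@msize_le2P _ (cmp a i)); last by rewrite [msize _]Aa.
by rewrite sum_ord3 2!addrA -!mul_mpolyC.
Qed.

Lemma comp_affine (c a0 a1 a2 : K) w :
  (c%:MP + a0%:MP * 'X_x + a1%:MP * 'X_y + a2%:MP * 'X_z) \mPo components w =
  c%:MP + a0%:MP * cmp w x + a1%:MP * cmp w y + a2%:MP * cmp w z.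
Proof.
by rewrite !mul_mpolyC 3!comp_mpolyD comp_mpolyC 3!comp_mpolyZ 3!XU_comp.
Qed.

Lemma cmp_affM a w i : Aff3 K a -> cmp (a * w)%g i =
  (cst a i)%:MP + (lin a i x)%:MP * cmp w x + (lin a i y)%:MP * cmp w y
  + (lin a i z)%:MP * cmp w z.
Proof. by move=> Aa; rewrite cmpM (aff_cmp _ Aa) comp_affine. Qed.

Lemma deg_affM_le a w m : Aff3 K a -> (forall i, (deg w i <= m)%N) ->
  forall i, (deg (a * w)%g i <= m)%N.
Proof.
by move=> Aa wm i; rewrite /deg cmp_affM //; apply: tdeg_affine_le; apply: wm.
Qed.

(** * The involutions [swap] and [shear] *)

Definition involution (phi : triple K)
  (phiK : triple_comp phi phi = triple_id K) : GA3 K.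
Proof.
by exists (phi, phi); rewrite /mutually_inverse /= phiK eqxx.
Defined.

Definition swap_triple : triple K := [tuple 'X_y; 'X_x; 'X_z].

Lemma swap_tripleK : triple_comp swap_triple swap_triple = triple_id K.
Proof.
by apply: eq_from_tnth; apply: ord3P;
  rewrite !tnth_mktuple !(tnth_nth 0) /= comp_mpolyXU.
Qed.

Definition swap := involution swap_tripleK.

Variable n : nat.

(** The sign of ['X_x] makes the shear its own inverse. *)
Definition shear_triple : triple K :=
  [tuple - 'X_x + 'X_y ^+ n * 'X_z; 'X_y; 'X_z].

Lemma shear_tripleK : triple_comp shear_triple shear_triple = triple_id K.
Proof.
apply: eq_from_tnth; apply: ord3P;
  rewrite !tnth_mktuple !(tnth_nth 0) /=;
  rewrite ?(comp_mpolyD, comp_mpolyN, rmorphM, rmorphXn) /= !comp_mpolyXU //=.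
by ring.
Qed.

Definition shear := involution shear_tripleK.

Lemma swap_x w : cmp (swap * w)%g x = cmp w y.
Proof. by rewrite cmpM /cmp (tnth_nth 0) /= XU_comp. Qed.
Lemma swap_y w : cmp (swap * w)%g y = cmp w x.
Proof. by rewrite cmpM /cmp (tnth_nth 0) /= XU_comp. Qed.
Lemma swap_z w : cmp (swap * w)%g z = cmp w z.
Proof. by rewrite cmpM /cmp (tnth_nth 0) /= XU_comp. Qed.

Lemma shear_x w : cmp (shear * w)%g x = - cmp w x + cmp w y ^+ n * cmp w z.
Proof.
rewrite cmpM /cmp (tnth_nth 0) /=.
by rewrite comp_mpolyD comp_mpolyN rmorphM rmorphXn /= !XU_comp.
Qed.
Lemma shear_y w : cmp (shear * w)%g y = cmp w y.
Proof. by rewrite cmpM /cmp (tnth_nth 0) /= XU_comp. Qed.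
Lemma shear_z w : cmp (shear * w)%g z = cmp w z.
Proof. by rewrite cmpM /cmp (tnth_nth 0) /= XU_comp. Qed.

Definition swapE := (swap_x, swap_y, swap_z).
Definition shearE := (shear_x, shear_y, shear_z).

Lemma cmp_swap : [/\ cmp swap x = 'X_y, cmp swap y = 'X_x & cmp swap z = 'X_z].
Proof. by []. Qed.

Lemma cmp_shear : [/\ cmp shear x = - 'X_x + 'X_y ^+ n * 'X_z,
  cmp shear y = 'X_y & cmp shear z = 'X_z].
Proof. by []. Qed.

Lemma swapK w : (swap * (swap * w))%g = w.
Proof. by apply: cmp_ext; rewrite !swapE. Qed.

Lemma shearK w : (shear * (shear * w))%g = w.
Proof. by apply: cmp_ext; rewrite !shearE //; ring. Qed.

(** * Dominant triples and the key step *)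

Definition dominant w := (deg w y < deg w x)%N /\ (deg w z < deg w x)%N.
(** The factor 2 supplies the hypothesis of [tdeg_shift_prod] for the first and third components. *)
Definition steep w := (deg w y < deg w x)%N /\ (2 * deg w z < deg w x)%N.

Lemma steepW w : steep w -> dominant w.
Proof. by rewrite /steep /dominant; lia. Qed.

(** After [swap] the dominant component is the one raised to the power [n], so the product outweighs
    the old second component. *)
Lemma deg_shear_swap w : (1 < n)%N -> dominant w ->
  [/\ deg (shear * (swap * w))%g x = (n * deg w x + deg w z)%N,
      deg (shear * (swap * w))%g y = deg w x &
      deg (shear * (swap * w))%g z = deg w z].
Proof.
move=> n1 [yx zx]; rewrite /deg !shearE !swapE; split=> //.
have xz := tdegMX n (deg_gt0 w x) (deg_gt0 w z).
by rewrite tdegDr xz // tdegN; move: yx; rewrite /deg; nia.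
Qed.

Lemma steep_shear_swap w :
  (1 < n)%N -> dominant w -> steep (shear * (swap * w))%g.
Proof.
move=> n1 dw; have [dx dy dz] := deg_shear_swap n1 dw.
rewrite /steep dx dy dz; move: dw (deg_gt0 w z); rewrite /dominant; nia.
Qed.

(* These are the affine maps whose conjugate by [shear] is still affine. *)
Definition aligned a := exists c k1 k2 s1 s2 : K,
  [/\ cmp a x = c%:MP + (s1 ^+ n * s2)%:MP * 'X_x + k1%:MP * 'X_y
                + k2%:MP * 'X_z,
      cmp a y = s1%:MP * 'X_y & cmp a z = s2%:MP * 'X_z].

(** Otherwise [a * u] would not involve [cmp u x] at all, and multiplying back by the inverse of [a]
    could not restore the degree of [cmp u x]. *)
Lemma aff_lin_x_neq0 a u : Aff3 K a ->
    (deg u y < deg u x)%N -> (deg u z < deg u x)%N ->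
  lin a y x = 0 -> lin a z x = 0 -> lin a x x != 0.
Proof.
move=> Aa yx zx ay az; apply/eqP => ax.
suff: (deg u x <= maxn (deg u y) (deg u z))%N by lia.
rewrite -{1}[u](mulKg a); apply: deg_affM_le; first exact: subgroupV.
have bound i : lin a i x = 0 ->
    (deg (a * u)%g i <= maxn (deg u y) (deg u z))%N.
  move=> ai; rewrite /deg cmp_affM // ai mpolyC0 mul0r addr0.
  apply: tdegD_le; last by rewrite tdegCM_le ?leq_maxr.
  by apply: tdegD_le; rewrite ?tdegC // tdegCM_le ?leq_maxl.
by apply: ord3P; apply: bound.
Qed.

(** If [cmp v x] enters the second or third component of [a * v], the new product has degree above
    [deg v x]. Otherwise these components are affine in [cmp u x] and [cmp u z], and the product can
    cancel against the one inside [cmp v x] only when [a] is aligned. *)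
Lemma shear_conj_dominant a u :
    (n = 2%N \/ n = 3%N) -> n%:R != 0 :> K -> Aff3 K a -> steep u ->
  dominant (shear * (a * (shear * (swap * u))))%g \/ aligned a.
Proof.
move=> n23 nK Aa su; have n1 : (1 < n)%N by case: n23 => ->.
set U := (swap * u)%g; set v := (shear * U)%g.
have [vx vy vz] := deg_shear_swap n1 (steepW su).
rewrite -/U -/v in vx vy vz.
set w := (a * v)%g.
have w_gt0 := deg_gt0 w.
have wE i : cmp w i = (cst a i)%:MP + (lin a i x)%:MP * cmp v x
    + (lin a i y)%:MP * cmp u x + (lin a i z)%:MP * cmp u z.
  by rewrite /w cmp_affM // /v !shear_y !shear_z /U !swapE.
have [yx zx] := su; have uz := deg_gt0 u z.
have uzx_lt : (deg u z < deg u x)%N by lia.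
have uzx := ltnW uzx_lt.
have vP : (deg u x < deg v x)%N by rewrite vx; nia.
have w_le i : (deg w i <= deg v x)%N.
  apply: deg_affM_le => //; apply: ord3P => //; rewrite ?vy ?vz; lia.
have w_le0 i : lin a i x = 0 -> (deg w i <= deg u x)%N.
  move=> ai; rewrite /deg wE ai mpolyC0 mul0r addr0.
  by do !apply: tdegD_le; rewrite ?tdegC //; apply: tdegCM_le.
have w_x i : lin a i x != 0 -> deg w i = deg v x.
  move=> ai; rewrite /deg wE.
  rewrite [(cst a i)%:MP + _]addrC -2!addrA.
  rewrite tdegDl tdegCM //; apply: leq_ltn_trans vP.
  by do !apply: tdegD_le; rewrite ?tdegC //; apply: tdegCM_le.
have prodE := tdegMX n (w_gt0 y) (w_gt0 z).
have dom : (deg v x < n * deg w y + deg w z)%N ->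
    dominant (shear * w)%g.
  move=> big; have wx_lt :
      (tdeg (- cmp w x) < n * tdeg (cmp w y) + tdeg (cmp w z))%N.
    by rewrite tdegN (leq_ltn_trans (w_le x)).
  have sx : deg (shear * w)%g x = (n * deg w y + deg w z)%N.
    by rewrite /deg shear_x tdegDr prodE.
  rewrite /dominant sx; split; rewrite /deg !shearE.
    by rewrite (leq_ltn_trans (w_le y)).
  by rewrite (leq_ltn_trans (w_le z)).
have [az|az] := eqVneq (lin a z x) 0; last first.
  by left; apply: dom; rewrite (w_x z az); move: (w_gt0 y); nia.
have [ay|ay] := eqVneq (lin a y x) 0; last first.
  by left; apply: dom; rewrite (w_x y ay); move: (w_gt0 z); nia.
have ax : lin a x x != 0.
  by apply: (@aff_lin_x_neq0 a v) => //; rewrite ?vy ?vz //; lia.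
(* Up to terms of degree at most [deg u x], [T] is the first component of
   [shear * w]. *)
set T := cmp w y ^+ n * cmp w z - (lin a x x)%:MP * (cmp u x ^+ n * cmp u z).
(* By now [cmp w y] and [cmp w z] have degree at most [deg u x], so it is enough that [T] exceeds
   this. *)
have domT : (deg u x < tdeg T)%N -> dominant (shear * w)%g.
  move=> Tbig; suff sx : (deg u x < deg (shear * w)%g x)%N.
    split; apply: leq_ltn_trans sx; rewrite /deg !shearE.
      exact: w_le0 y ay.
    exact: w_le0 z az.
  rewrite /deg shear_x wE /v shear_x /U !swapE.
  rewrite -/w; move: (cst a x) (lin a x y) (lin a x z) @T Tbig => c k1 k2.
  move: (cmp w y ^+ n * cmp w z) (cmp u x ^+ n * cmp u z) => P Q T Tbig.
  have -> : - (c%:MP + (lin a x x)%:MP * (- cmp u y + Q) + k1%:MP * cmp u x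
      + k2%:MP * cmp u z) + P =
     T + ((- c)%:MP + (lin a x x)%:MP * cmp u y + (- k1)%:MP * cmp u x
      + (- k2)%:MP * cmp u z).
    by rewrite /T !mpolyCN; move: (lin a x x)%:MP => s; ring.
  rewrite tdegDl //; apply: leq_ltn_trans Tbig.
  by apply: tdeg_affine_le => //; apply: ltnW.
have wyE : cmp w y = (cst a y)%:MP + (lin a y y)%:MP * cmp u x
    + (lin a y z)%:MP * cmp u z by rewrite wE ay mpolyC0 mul0r addr0.
have wzE : cmp w z = (cst a z)%:MP + (lin a z y)%:MP * cmp u x
    + (lin a z z)%:MP * cmp u z by rewrite wE az mpolyC0 mul0r addr0.
have w_y i : lin a i x = 0 -> lin a i y != 0 -> deg w i = deg u x.
  move=> ai aiy; rewrite /deg wE ai mpolyC0 mul0r addr0.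
  rewrite [(cst a i)%:MP + _]addrC -addrA.
  rewrite tdegDl tdegCM //; apply: leq_ltn_trans uzx_lt.
  by apply: tdegD_le; rewrite ?tdegC ?tdegCM_le.
have w_z i : lin a i x = 0 -> lin a i y = 0 -> (deg w i <= deg u z)%N.
  move=> ai aiy; rewrite /deg wE ai aiy mpolyC0 !mul0r !addr0.
  by apply: tdegD_le; rewrite ?tdegC ?tdegCM_le.
have uprodE := tdegMX n (deg_gt0 u x) (deg_gt0 u z).
have suprodE : tdeg ((lin a x x)%:MP * (cmp u x ^+ n * cmp u z)) =
    (n * deg u x + deg u z)%N by rewrite tdegCM.
have [azy|azy] := eqVneq (lin a z y) 0; last first.
  (* Here [cmp w z] has the degree of [cmp u x], so the two products in [T] have different degrees
     and cannot cancel. *)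
  left; apply: domT.
  have wzP := w_y z az azy.
  have [ayy|ayy] := eqVneq (lin a y y) 0.
    have lt : (n * deg w y + deg w z < n * deg u x + deg u z)%N.
      by move: (w_z y ay ayy); rewrite wzP; nia.
    suff -> : tdeg T = (n * deg u x + deg u z)%N by nia.
    by rewrite /T tdegDr ?tdegN suprodE ?prodE.
  have wyP := w_y y ay ayy.
  have lt : (n * deg u x + deg u z < n * deg w y + deg w z)%N.
    by rewrite wzP wyP; nia.
  suff -> : tdeg T = (n * deg w y + deg w z)%N by nia.
  by rewrite /T tdegDl ?tdegN ?suprodE prodE.
have azz : lin a z z != 0.
  apply/eqP => azz; move: (w_gt0 z).
  by rewrite /deg wzE azy azz mpolyC0 !mul0r !addr0 tdegC.
have ayy : lin a y y != 0.
  apply/eqP => ayy.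
  (* Both [cmp w y] and [cmp w z] would be affine in [cmp u z]; [l] eliminates it, so [l] becomes
     constant after composition with [w], despite its coefficient [lin a z z]. *)
  pose l : {mpoly K[3]} := (lin a z z)%:MP * 'X_y - (lin a y z)%:MP * 'X_z.
  have lE : l = (lin a z z * cst a y - lin a y z * cst a z)%:MP.
    apply: (@comp_const _ w); rewrite /l !mul_mpolyC comp_mpolyB !comp_mpolyZ.
    rewrite !XU_comp wyE wzE ayy azy mpolyC0 !mul0r !addr0 -!mul_mpolyC.
    rewrite mpolyCB !mpolyCM; move: (lin a z z)%:MP (lin a y z)%:MP => s1 s2.
    by move: (cst a y)%:MP (cst a z)%:MP => s3 s4; ring.
  have := congr1 (mcoeff U_(y)) lE.
  rewrite /l mcoeffB !mcoeffCM !mcoeffX mcoeffC !eq_mnm1 mnm1_eq0 !mulr0 mulr1.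
  by rewrite subr0; apply/eqP.
pose d := (cst a y / lin a y y)%:MP + (lin a y z / lin a y y)%:MP * cmp u z.
pose c := cst a z / lin a z z.
have wyD : cmp w y = (lin a y y)%:MP * (cmp u x + d).
  by rewrite wyE affine_factor.
have wzC : cmp w z = (lin a z z)%:MP * (cmp u z + c%:MP).
  by rewrite wzE azy mpolyC0 mul0r addr0 /c mulrDr mulC_divK // addrC.
have dq : (tdeg d <= deg u z)%N.
  by rewrite /d tdegD_le ?tdegC ?tdegCM_le.
have TE : T = (lin a y y ^+ n * lin a z z)%:MP *
    ((cmp u x + d) ^+ n * (cmp u z + c%:MP))
    - (lin a x x)%:MP * (cmp u x ^+ n * cmp u z).
  rewrite /T wyD wzC exprMn mpolyCM rmorphXn /=.
  congr (_ - _); rewrite mulrACA; congr (_ * _).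
have [/and3P[/eqP d0 /eqP c0 /eqP mE]|nexc] := boolP
  [&& d == 0, c == 0 & lin a y y ^+ n * lin a z z == lin a x x].
- right; exists (cst a x), (lin a x y), (lin a x z), (lin a y y), (lin a z z).
  have ayz : lin a y z = 0.
    apply: contra_eq d0 => ayz; apply: tdeg_neq0.
    have E : tdeg ((lin a y z / lin a y y)%:MP * cmp u z) = deg u z.
      by rewrite tdegCM // mulf_neq0 ?invr_eq0.
    by rewrite /d tdegDr ?tdegC E.
  have csty : cst a y = 0.
    move/eqP: d0; rewrite /d ayz mul0r mpolyC0 mul0r addr0 mpolyC_eq0.
    by rewrite mulf_eq0 invr_eq0 (negbTE ayy) orbF => /eqP.
  have cstz : cst a z = 0.
    by move/eqP: c0; rewrite mulf_eq0 invr_eq0 (negbTE azz) orbF => /eqP.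
  rewrite mE; split; rewrite (aff_cmp _ Aa) //.
    by rewrite ay ayz csty mpolyC0 !mul0r !addr0 add0r.
  by rewrite az azy cstz mpolyC0 !mul0r !addr0 add0r.
left; apply: domT; rewrite TE.
have {}nexc :
    ~ [/\ d = 0, c = 0 & lin a y y ^+ n * lin a z z = lin a x x].
  by case=> d0 c0 mE; rewrite d0 c0 mE !eqxx in nexc.
have m0 : lin a y y ^+ n * lin a z z != 0 by rewrite mulf_neq0 ?expf_neq0.
exact: (tdeg_shift_prod n23 nK (deg_gt0 u z) uzx_lt dq m0 zx nexc).
Qed.

(** * The exceptional affine maps and their conjugates *)

Lemma tdeg_var i : tdeg ('X_i : {mpoly K[3]}) = 1%N.
Proof. by rewrite /tdeg msizeX mdeg1. Qed.

Lemma deg_le1_Aff a : (forall i, (deg a i <= 1)%N) -> Aff3 K a.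
Proof.
by move=> a1; apply: Aff3_memP => i; move: (a1 i); rewrite /deg /tdeg /cmp; lia.
Qed.

Lemma aligned_Aff a : aligned a -> Aff3 K a.
Proof.
case=> c [k1] [k2] [s1] [s2] [ax ay az]; apply: deg_le1_Aff.
apply: ord3P; rewrite /deg ?ax ?ay ?az.
- by apply: tdeg_affine_le; rewrite tdeg_var.
- by rewrite tdegCM_le ?tdeg_var.
- by rewrite tdegCM_le ?tdeg_var.
Qed.

(** The nonlinear terms cancel since both monomials scale by [s1 ^+ n * s2]; only [c], [k1] and [k2]
    change sign. *)
Lemma aligned_shear_conj a : aligned a -> aligned (shear * (a * shear))%g.
Proof.
case=> c [k1] [k2] [s1] [s2] [ax ay az].
have [sx sy sz] := cmp_shear.
exists (- c), (- k1), (- k2), s1, s2; rewrite !shearE !cmpM ax ay az.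
rewrite comp_affine !mul_mpolyC !comp_mpolyZ !XU_comp sx sy sz; split=> //.
rewrite exprZn -!mul_mpolyC !mpolyCN !mpolyCM rmorphXn /=.
move: c%:MP k1%:MP k2%:MP s1%:MP s2%:MP => C1 C2 C3 C4 C5.
move: ('X_y ^+ n) (C4 ^+ n) => C6 C7; ring.
Qed.

(* The diagonal maps that commute with both [shear] and its conjugate by
   [swap]. *)
Definition weighted a := exists s0 s1 s2 : K,
  [/\ cmp a x = s0%:MP * 'X_x, cmp a y = s1%:MP * 'X_y,
      cmp a z = s2%:MP * 'X_z, s0 = s1 ^+ n * s2 & s1 = s0 ^+ n * s2].

(** Conjugation by [swap] moves the first component to the second place, where alignment allows only
    a multiple of ['X_y]; this kills [c], [k1] and [k2], and comparing scalars gives the second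
    weight relation. *)
Lemma aligned_weighted a :
  aligned a -> aligned (swap * (a * swap))%g -> weighted a.
Proof.
case=> c [k1] [k2] [s1] [s2] [ax ay az] [c'] [k1'] [k2'] [s1'] [s2'].
have [px py pz] := cmp_swap.
rewrite !swapE !cmpM ax ay az comp_affine !mul_mpolyC !comp_mpolyZ !XU_comp.
rewrite px py pz -!mul_mpolyC => -[E1 E2 E3].
have := congr1 (mcoeff 0%MM) E2.
rewrite !(mcoeffD, mcoeffCM, mcoeffX, mcoeffC) !mnm1_eq0 eqxx /=.
have := congr1 (mcoeff U_(x)) E2; have := congr1 (mcoeff U_(y)) E2.
have := congr1 (mcoeff U_(z)) E2; have := congr1 (mcoeff U_(z)) E3.
have := congr1 (mcoeff U_(x)) E1.
rewrite !(mcoeffD, mcoeffCM, mcoeffX, mcoeffC) !eq_mnm1 !mnm1_eq0 /=.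
rewrite !(mulr0, mulr1, addr0, add0r) => e1 e2 k20 s1E k10 c0.
exists (s1 ^+ n * s2), s1, s2; rewrite ax ay az k20 k10 c0.
rewrite mpolyC0 !mul0r !addr0 add0r; split=> //.
by rewrite s1E [in RHS]e2.
Qed.

Lemma swap_Aff : Aff3 K swap.
Proof.
by apply: ord3P; rewrite -/(cmp swap _) /cmp (tnth_nth 0) /= msizeX mdeg1.
Qed.

Lemma weighted_Aff a : weighted a -> Aff3 K a.
Proof.
case=> s0 [s1] [s2] [ax ay az _ _]; apply: deg_le1_Aff.
by apply: ord3P; rewrite /deg ?ax ?ay ?az tdegCM_le ?tdeg_var.
Qed.

Lemma weighted_shear_conj a : weighted a -> (shear * (a * shear))%g = a.
Proof.
case=> s0 [s1] [s2] [ax ay az s0E _].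
have [sx sy sz] := cmp_shear.
apply: cmp_ext; rewrite !shearE !cmpM ?ax ?ay ?az !mul_mpolyC !comp_mpolyZ
  !XU_comp ?sx ?sy ?sz //.
rewrite exprZn -!mul_mpolyC s0E mpolyCM rmorphXn /=.
move: s1%:MP s2%:MP => C1 C2; move: ('X_y ^+ n) (C1 ^+ n) => C3 C4; ring.
Qed.

Lemma weighted_swap_conj a : weighted a -> weighted (swap * (a * swap))%g.
Proof.
case=> s0 [s1] [s2] [ax ay az s0E s1E]; have [px py pz] := cmp_swap.
exists s1, s0, s2; rewrite !swapE !cmpM ax ay az !mul_mpolyC !comp_mpolyZ.
by rewrite !XU_comp px py pz; split.
Qed.

(** * The automorphism [theta] and its action on degrees *)

Definition turn w := (shear * (swap * w))%g.
Definition theta := turn (turn (turn (turn shear))).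

Lemma shearshear : (shear * shear)%g = 1%g.
Proof. by rewrite -[X in (_ * X)%g]mulg1 shearK. Qed.

Lemma thetaM w : (theta * w)%g = turn (turn (turn (turn (shear * w)%g))).
Proof. by rewrite /theta /turn !mulgA. Qed.

(** [theta] is a palindrome in two involutions. *)
Lemma thetaK w : (theta * (theta * w))%g = w.
Proof. by rewrite !thetaM /turn !(shearK, swapK). Qed.

(* Two turns are recorded since a reduction may undo the last one. *)
Definition peaked w := exists2 u, steep u & w = turn (turn u).

Section PingPong.
Hypotheses (n23 : n = 2%N \/ n = 3%N) (nK : n%:R != 0 :> K).

Let n_gt1 : (1 < n)%N. Proof. by case: n23 => ->. Qed.

Lemma steep_turn w : dominant w -> steep (turn w).
Proof. exact: steep_shear_swap. Qed.

Lemma steep_turnW w : steep w -> steep (turn w).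
Proof. by move=> /steepW/steep_turn. Qed.

(** The rightmost [shear] already gives degrees [n.+1], 1, 1. Of the four turns that follow, the
    last two are those recorded by [peaked]. *)
Lemma peaked_theta_Aff a : Aff3 K a -> peaked (theta * a)%g.
Proof.
move=> Aa; exists (turn (turn (shear * a)%g)); last exact: thetaM.
apply/steep_turnW/steep_turn.
have d1 i : deg a i = 1%N by rewrite /deg /tdeg [msize _]Aa.
have dx : deg (shear * a)%g x = n.+1.
  have xz := tdegMX n (deg_gt0 a y) (deg_gt0 a z).
  rewrite /deg shear_x tdegDr xz ?tdegN -!/(deg a _) !d1; lia.
by rewrite /dominant dx /deg shear_y shear_z -!/(deg a _) !d1; lia.
Qed.

(** Conjugation by [theta] is nine alternating conjugations by [shear] and [swap], each preserving
    weighted maps. *)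
Lemma theta_conj_weighted a : weighted a -> Aff3 K (theta * (a * theta))%g.
Proof.
move=> wa.
have shW b : weighted b -> weighted (shear * (b * shear))%g.
  by move=> wb; rewrite weighted_shear_conj.
have -> : (theta * (a * theta))%g =
    let A f b := (f * (b * f))%g in
    A shear (A swap (A shear (A swap (A shear (A swap (A shear
      (A swap (A shear a)))))))) by rewrite /theta /turn /= !mulgA.
by apply/weighted_Aff/shW; do 4!apply/weighted_swap_conj/shW.
Qed.

(** The key step is applied to [a], then, if [a] is aligned, to [a2] across the earlier turn; two
    failures make [a] weighted. *)
Lemma peaked_theta a w : Aff3 K a -> peaked w ->
  peaked (theta * (a * w))%g \/ Aff3 K (theta * (a * theta))%g.
Proof.
move=> Aa [u su ->].
have [dom|al] := shear_conj_dominant n23 nK Aa (steep_turnW su).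
  left; exists (turn (turn (shear * (a * turn (turn u))))%g).
    exact/steep_turnW/steep_turn.
  exact: thetaM.
have al1 := aligned_shear_conj al.
set a1 := (shear * (a * shear))%g in al1.
have aE : a = (shear * (a1 * shear))%g.
  by rewrite /a1 -!mulgA shearK shearshear mulg1.
set a2 := (swap * (a1 * swap))%g.
have Aa2 : Aff3 K a2.
  exact: (subgroupM swap_Aff (subgroupM (aligned_Aff al1) swap_Aff)).
have [dom|al2] := shear_conj_dominant n23 nK Aa2 su.
  (* Three turns remain after the cancellation: one to become steep and two to record. *)
  left; exists (turn (shear * (a2 * turn u)))%g; first exact: steep_turn.
  by rewrite thetaM {1}aE /a2 /turn -!mulgA !(shearK, swapK).
right; have w1 := aligned_weighted al1 al2.
have wa : weighted a by rewrite (etrans aE (weighted_shear_conj w1)).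
exact: theta_conj_weighted.
Qed.

(** * Reduced words and normal forms *)

Inductive reduced : GA3 K -> Prop :=
| reduced1 a : Aff3 K a -> reduced (theta * a)%g
| reducedM a w : Aff3 K a -> reduced w -> ~ Aff3 K (theta * (a * theta))%g ->
    reduced (theta * (a * w))%g.

(** The last premise of [reducedM] excludes the second outcome of [peaked_theta]. *)
Lemma reduced_peaked w : reduced w -> peaked w.
Proof.
elim=> [a|a {}w Aa _ pw nA]; first exact: peaked_theta_Aff.
by case: (peaked_theta Aa pw).
Qed.

Definition normal w :=
  Aff3 K w \/ exists a w', [/\ Aff3 K a, reduced w' & w = (a * w')%g].

Lemma normal_Aff a w : Aff3 K a -> normal w -> normal (a * w)%g.
Proof.
move=> Aa [Aw|[b [w' [Ab rw ->]]]]; first by left; apply: subgroupM.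
by right; exists (a * b)%g, w'; split; [apply: subgroupM | | rewrite mulgA].
Qed.

(** If [theta * a * theta] is affine it merges with the next affine letter and shortens the word;
    otherwise the longer word is reduced. *)
Lemma normal_theta w : normal w -> normal (theta * w)%g.
Proof.
case=> [Aw|[a [w' [Aa rw ->]]]].
  right; exists 1%g, (theta * w)%g; rewrite mul1g.
  by split; [apply: subgroup1 | apply: reduced1 |].
(* The boolean test on sizes decides membership in [Aff3], which is a proposition. *)
have [/forallP Ag|/forallP nAg] :=
    boolP [forall i, msize (cmp (theta * (a * theta)) i)%g == 2%N].
  have assoc (t v : GA3 K) : (t * (a * (t * v)))%g = (t * (a * t) * v)%g.
    by rewrite !mulgA.
  have {}Ag : Aff3 K (theta * (a * theta))%g by move=> i; apply/eqP/Ag.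
  case: w' / rw => [b Ab|b w' Ab rw _].
    by left; rewrite assoc; apply: subgroupM.
  rewrite assoc; apply: normal_Aff => //.
  by right; exists b, w'.
right; exists 1%g, (theta * (a * w'))%g; rewrite mul1g; split=> //.
  exact: subgroup1.
by apply: reducedM => // Ag; apply: nAg => i; apply/eqP/Ag.
Qed.

(** Closure of [normal] under products is not evident, so the subgroup used is [H], the elements
    that preserve normality by left multiplication together with their inverses. *)
Lemma generated_normal w :
  generated (fun f => Aff3 K f \/ f = theta) w -> normal w.
Proof.
pose H w := forall v, normal v -> normal (w * v)%g /\ normal (w^-1 * v)%g.
have H1 : H 1%g by move=> v nv; rewrite invg1 mul1g.
have HM f h : H f -> H h -> H (f * h)%g.
  move=> Hf Hh v nv; rewrite invgM -!mulgA.
  by split; [case: (Hh v nv) => /Hf[] | case: (Hf v nv) => _ /Hh[]].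
have HV f : H f -> H (f^-1)%g by move=> Hf v /Hf[]; rewrite invgK.
move=> Gw; have /(_ _ 1%g)[] := Gw (Subgroup H1 HM HV).
- move=> f [Af|->] v nv.
    by split; apply: normal_Aff => //; apply: subgroupV.
  split; first exact: normal_theta.
  suff -> : (theta^-1 * v = theta * v)%g by apply: normal_theta.
  by rewrite -{1}[v]thetaK mulKg.
- by left; apply: subgroup1.
by rewrite mulg1.
Qed.

(** * [shear] is tame but has no normal form; [theta] is tame but not affine *)

Lemma deg_shear :
  [/\ deg shear x = n.+1, deg shear y = 1%N & deg shear z = 1%N].
Proof.
have [cx cy cz] := cmp_shear.
rewrite /deg cx cy cz !tdeg_var; split=> //.
have E : tdeg ('X_y ^+ n * 'X_z : {mpoly K[3]}) = n.+1.
  by rewrite tdegMX !tdeg_var // muln1 addn1.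
by rewrite tdegDr ?tdegN E // tdeg_var; lia.
Qed.

Lemma deg_peaked w : peaked w -> (n.+1 < deg w x)%N.
Proof.
case=> u su ->.
have [-> _ _] := deg_shear_swap n_gt1 (steepW (steep_turnW su)).
have [-> _ _] := deg_shear_swap n_gt1 (steepW su).
by move: su (deg_gt0 u z); rewrite /steep; nia.
Qed.

(** Stripping the affine factor leaves a reduced word of degree at most [n.+1], against
    [deg_peaked]. *)
Lemma shear_not_normal : ~ normal shear.
Proof.
have [sx sy sz] := deg_shear.
case=> [As|[a [w [Aa rw E]]]].
  by move: sx; rewrite /deg /tdeg [msize _]As; lia.
have := deg_peaked (reduced_peaked rw); rewrite ltnNge => /negP; apply.
have -> : w = (a^-1 * shear)%g by rewrite E mulKg.
apply: deg_affM_le; first exact: subgroupV.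
by apply: ord3P; rewrite ?sx ?sy ?sz.
Qed.

Lemma theta_not_Aff : ~ Aff3 K theta.
Proof.
move=> Ag; have := deg_peaked (peaked_theta_Aff (subgroup1 (Aff3 K))).
by rewrite mulg1 /deg /tdeg [msize _]Ag.
Qed.

Lemma shear_TA : TA3 K shear.
Proof.
move=> H; apply; right; apply: ord3P.
- exists (-1), ('X_y ^+ n * 'X_z); rewrite oppr_eq0 oner_eq0; split=> //.
    move=> m i; rewrite mpolyXn -mpolyXD msuppX inE => /eqP -> i0.
    have -> : i = x by apply: val_inj; move: i0; rewrite /= lt0n negbK => /eqP.
    by rewrite mnmDE mulmnE !mnm1E.
  by rewrite scaleN1r.
- exists 1, 0; rewrite oner_eq0 scale1r addr0.
  by split=> // m i; rewrite msupp0.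
exists 1, 0; rewrite oner_eq0 scale1r addr0.
by split=> // m i; rewrite msupp0.
Qed.

Lemma theta_TA : TA3 K theta.
Proof.
have St := shear_TA.
have Sw : TA3 K swap by move=> H; apply; left; apply: swap_Aff.
by do 4!(apply: subgroupM => //; apply: subgroupM => //).
Qed.

End PingPong.
End Action.

(** * A subgroup strictly between the affine and the tame group *)

Theorem corollary1 (K : fieldType) : ~ maximal_subgroup (Aff3 K) (TA3 K).
Proof.
(* If 2 vanishes in [K], then 3 equals 1 there. *)
have [n n23 nK] : exists2 n, n = 2%N \/ n = 3%N & n%:R != 0 :> K.
  have [K2|K2] := eqVneq (2%:R : K) 0; last by exists 2%N; [left|].
  by exists 3%N; [right | rewrite mulrSr K2 add0r oner_eq0].
case=> _ _ /(_ (generated (fun f => Aff3 K f \/ f = theta K n))) [].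
- by move=> f Af H; apply; left.
- move=> f Gf; apply: Gf => h [Ah|->]; last exact: theta_TA.
  by move=> H; apply; left.
- move=> /(_ (theta K n)) sub; apply: (theta_not_Aff n23 nK); apply: sub => H.
  by apply; right.
move=> /(_ _ (@shear_TA K n)) /generated_normal.
exact: shear_not_normal n23 nK.
Qed.
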